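(* Let $\kappa$ be a field. (a) If $G$ is a finite group with a subgroup $H$ of index $2$, $R$ is a nonempty conjugacy-closed set of involutions in $G \setminus H$, and $\zeta \in \kappa^\times$ is a root of unity whose order does not divide the exponent of $H$, then $\deg C(\kappa R_\zeta) = 1$. (b) If $G$ is the symmetric group $S_N$, $R$ is the conjugacy class of transpositions, and $\zeta \in \kappa$ is a root of unity whose order does not divide $3$, then $\deg C(\kappa R_\zeta) \leq \lfloor N/2 \rfloor$.
   Context: For a conjugacy-closed subset $R$ of a group, write $x^y = y^{-1}xy$. $\kappa R_\zeta$ is the $\kappa$-vector space with basis $R$ and braiding $T(x \otimes y) = \zeta\, y \otimes x^y$. The Artin braid group $B_n$ acts on $\kappa R_\zeta^{\otimes n}$ with the generator $\sigma_i$ acting by $T$ on tensor positions $i,i+1$. $C(\kappa R_\zeta) = \bigoplus_{n \ge 0} H_0(B_n, \kappa R_\zeta^{\otimes n})$ is the graded algebra of coinvariants, and $\deg C(\kappa R_\zeta)$ is the largest $n$ for which the $n$th summand is nonzero. *)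

(* Defs.v *)
From HB Require Import structures.
From mathcomp Require Import all_boot all_order all_algebra.
From mathcomp Require Import all_fingroup all_solvable.
From mathcomp Require Import boolp zify.

Set Implicit Arguments.
Unset Strict Implicit.
Unset Printing Implicit Defensive.

Import GRing.Theory.
Local Open Scope ring_scope.

(* The Artin braid group [B_n] on [n] strands, by its presentation. The letter
   [(i, false)] is the generator sigma_(i+1), and [(i, true)] its inverse.
   For [n <= 1] there are no generators and the group is trivial. *)
Definition braid_word (n : nat) := seq ('I_n.-1 * bool).

Definition sig_word n (i : 'I_n.-1) : braid_word n := [:: (i, false)].
Definition inv_letter n (a : 'I_n.-1 * bool) := (a.1, ~~ a.2).
Definition inv_word n (w : braid_word n) : braid_word n :=
  rev (map (@inv_letter n) w).

Inductive braid_eq n : braid_word n -> braid_word n -> Prop :=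
| braid_refl u : braid_eq u u
| braid_sym u v : braid_eq u v -> braid_eq v u
| braid_trans u v w : braid_eq u v -> braid_eq v w -> braid_eq u w
| braid_cat u u' v v' :
    braid_eq u u' -> braid_eq v v' -> braid_eq (u ++ v) (u' ++ v')
| braid_cancel a : braid_eq [:: a; inv_letter a] [::]
| braid_far (i j : 'I_n.-1) : (i.+1 < j)%N ->
    braid_eq (sig_word i ++ sig_word j) (sig_word j ++ sig_word i)
| braid_artin (i j : 'I_n.-1) : j = i.+1 :> nat ->
    braid_eq (sig_word i ++ sig_word j ++ sig_word i)
             (sig_word j ++ sig_word i ++ sig_word j).

Definition braid_eqb n : rel (braid_word n) := fun u v => `[< braid_eq u v >].

Lemma braid_eqb_equiv n : equiv_class_of (@braid_eqb n).
Proof.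
split=> [u|u v|v u w].
- exact/asboolP/braid_refl.
- by apply/asboolP/asboolP; apply: braid_sym.
- move=> /asboolP uv /asboolP vw; apply/asboolP; exact: braid_trans uv vw.
Qed.

Canonical braid_equiv n := EquivRelPack (@braid_eqb_equiv n).

Definition braid_group (n : nat) := {eq_quot @braid_eqb n}%qT.

HB.instance Definition _ n := Choice.on (braid_group n).

Section BraidGroup.
Local Open Scope quotient_scope.
Variable n : nat.
Implicit Types (u v w : braid_word n) (x y z : braid_group n).

(* [fingroup] shadows the name [repr]. *)
Local Notation rep := generic_quotient.repr.

Definition braid_of_word w : braid_group n := \pi_{eq_quot @braid_eqb n} w.

Lemma braid_of_wordP u v : braid_of_word u = braid_of_word v <-> braid_eq u v.
Proof.
split=> [/eqP|uv]; rewrite /braid_of_word; first by rewrite eqmodE => /asboolP.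
by apply/eqP; rewrite eqmodE; apply/asboolP.
Qed.

Lemma braid_reprK x : braid_of_word (rep x) = x.
Proof. exact: reprK. Qed.

Lemma repr_braid_of_word u : braid_eq (rep (braid_of_word u)) u.
Proof. by apply/braid_of_wordP; rewrite braid_reprK. Qed.

Lemma inv_letterK : involutive (@inv_letter n).
Proof. by case=> i b; rewrite /inv_letter /= negbK. Qed.

Lemma inv_word_cat u v : inv_word (u ++ v) = inv_word v ++ inv_word u.
Proof. by rewrite /inv_word map_cat rev_cat. Qed.

Lemma braid_mulwV u : braid_eq (u ++ inv_word u) [::].
Proof.
elim: u => [|a u IH]; first exact: braid_refl.
rewrite -cat1s inv_word_cat -catA (catA u).
apply: braid_trans (braid_cancel a).
apply: (@braid_cat _ [:: a] [:: a] _ [:: inv_letter a]); first exact: braid_refl.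
exact: (@braid_cat _ _ [::] [:: _] [:: _] IH (braid_refl _)).
Qed.

Lemma inv_wordK u : inv_word (inv_word u) = u.
Proof. by rewrite /inv_word map_rev revK (mapK inv_letterK). Qed.

Lemma braid_mulVw u : braid_eq (inv_word u ++ u) [::].
Proof. by rewrite -{2}[u]inv_wordK; apply: braid_mulwV. Qed.

Definition braid_one : braid_group n := braid_of_word [::].
Definition braid_mul x y := braid_of_word (rep x ++ rep y).
Definition braid_inv x := braid_of_word (inv_word (rep x)).

Fact braid_mulA : associative braid_mul.
Proof.
move=> x y z; apply/braid_of_wordP.
apply: (@braid_trans _ _ (rep x ++ rep y ++ rep z)).
  by apply: braid_cat (braid_refl _) (repr_braid_of_word _).
rewrite catA; apply: braid_cat (braid_refl _).
exact/braid_sym/repr_braid_of_word.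
Qed.

Fact braid_mul1 : left_id braid_one braid_mul.
Proof.
move=> x; rewrite -[RHS]braid_reprK; apply/braid_of_wordP.
by apply: (@braid_cat _ _ [::]); [apply: repr_braid_of_word | apply: braid_refl].
Qed.

Fact braid_1mul : right_id braid_one braid_mul.
Proof.
move=> x; rewrite -[RHS]braid_reprK; apply/braid_of_wordP; rewrite -[X in braid_eq _ X]cats0.
by apply: braid_cat; [apply: braid_refl | apply: repr_braid_of_word].
Qed.

Fact braid_mulV : left_inverse braid_one braid_inv braid_mul.
Proof.
move=> x; apply/braid_of_wordP; apply: braid_trans (braid_mulVw (rep x)).
exact: braid_cat (repr_braid_of_word _) (braid_refl _).
Qed.

Fact braid_Vmul : right_inverse braid_one braid_inv braid_mul.
Proof.
move=> x; apply/braid_of_wordP; apply: braid_trans (braid_mulwV (rep x)).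
exact: braid_cat (braid_refl _) (repr_braid_of_word _).
Qed.

HB.instance Definition _ := isGroup.Build (braid_group n)
  braid_mulA braid_mul1 braid_1mul braid_mulV braid_Vmul.

Definition sigma (i : 'I_n.-1) : braid_group n := braid_of_word (sig_word i).

Lemma braid_of_word_cat u v :
  braid_of_word (u ++ v) = (braid_of_word u * braid_of_word v)%g.
Proof.
apply/braid_of_wordP; apply: braid_sym.
exact: braid_cat (repr_braid_of_word _) (repr_braid_of_word _).
Qed.

End BraidGroup.

Section Coinvariants.
Variables (kappa : fieldType) (B : groupType) (M : lmodType kappa).
Variable act : B -> M -> M.

Definition coinv_sub : {pred M} := fun v =>
  `[< exists s : seq (kappa * (B * M)),
        v = \sum_(p <- s) p.1 *: (act p.2.1 p.2.2 - p.2.2) >].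

Fact coinv_sub_closed : zmod_closed coinv_sub.
Proof.
split; first by apply/asboolP; exists [::]; rewrite big_nil.
move=> _ _ /asboolP[s ->] /asboolP[t ->]; apply/asboolP.
exists (s ++ [seq (- p.1, p.2) | p <- t]).
rewrite big_cat big_map /= -sumrN; congr (_ + _).
by apply: eq_bigr => p _; rewrite scaleNr.
Qed.

HB.instance Definition _ := GRing.isZmodClosed.Build M coinv_sub coinv_sub_closed.

(* [coinv_sub] is the kappa-span of the [g m - m]; despite its name,
   [{ideal_quot _}] is the quotient of an additive group by a subgroup. *)
Definition H0 : zmodType := {ideal_quot coinv_sub}.

End Coinvariants.

Record conj_set (G : finGroupType) := ConjSet {
  conj_set_val :> {set G};
  conj_setP : forall x y : G, x \in conj_set_val -> (x ^ y)%g \in conj_set_val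
}.

Section RackAlgebra.
Variables (G : finGroupType) (R : conj_set G).

Definition elt := {x : G | x \in (R : {set G})}.

Definition conj_elt (x y : elt) : elt :=
  exist _ (val x ^ val y)%g (conj_setP (val y) (valP x)).

Definition conjV_elt (x y : elt) : elt :=
  exist _ (val x ^ (val y)^-1)%g (conj_setP (val y)^-1%g (valP x)).

Lemma conj_eltK y : cancel (conj_elt^~ y) (conjV_elt^~ y).
Proof. by move=> x; apply: val_inj; rewrite /= conjgK. Qed.

Lemma conjV_eltK y : cancel (conjV_elt^~ y) (conj_elt^~ y).
Proof. by move=> x; apply: val_inj; rewrite /= conjgKV. Qed.

Section Tensors.
Variable n : nat.

(* The monomial [t 0 (x) ... (x) t (n-1)]. *)
Definition monomial := {ffun 'I_n -> elt}.

(* The entries [x] at [a] and [y] at [b] become [y] at [a] and [x ^ y] at [b]. *)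
Definition braid_move (a b : 'I_n) (t : monomial) : monomial :=
  [ffun k => if k == a then t b
             else if k == b then conj_elt (t a) (t b) else t k].

Definition braid_moveV (a b : 'I_n) (t : monomial) : monomial :=
  [ffun k => if k == a then conjV_elt (t b) (t a)
             else if k == b then t a else t k].

Lemma braid_moveK a b : a != b -> cancel (braid_move a b) (braid_moveV a b).
Proof.
move=> /negPf ab t; apply/ffunP => k; rewrite !ffunE !eqxx (eq_sym b) ab.
by case: eqP => [->|_]; [exact: conj_eltK | case: eqP => [->|]].
Qed.

Lemma braid_moveVK a b : a != b -> cancel (braid_moveV a b) (braid_move a b).
Proof.
move=> /negPf ab t; apply/ffunP => k; rewrite !ffunE !eqxx (eq_sym b) ab.
by case: eqP => [->|_] //; case: eqP => [->|] //; exact: conjV_eltK.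
Qed.

Lemma braid_move_far a b c d t : uniq [:: a; b; c; d] ->
  braid_move a b (braid_move c d t) = braid_move c d (braid_move a b t).
Proof.
rewrite /= !inE !negb_or => /and4P[/and3P[ab ac ad] /andP[bc bd] cd _].
have E := (negPf ab, negPf ac, negPf ad, negPf bc, negPf bd, negPf cd).
have E' := (eq_sym b a, eq_sym c a, eq_sym d a, eq_sym c b, eq_sym d b, eq_sym d c).
apply/ffunP => k; rewrite !ffunE ?E ?E' ?E.
case: (eqVneq k a) => [->|_]; first by rewrite ?E.
by case: (eqVneq k b) => [->|_]; rewrite ?E.
Qed.

Lemma braid_move_artin a b c t : uniq [:: a; b; c] ->
  braid_move a b (braid_move b c (braid_move a b t)) =
  braid_move b c (braid_move a b (braid_move b c t)).
Proof.
rewrite /= !inE !negb_or => /and3P[/andP[ab ac] bc _].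
have E := (negPf ab, negPf ac, negPf bc).
have E' := (eq_sym b a, eq_sym c a, eq_sym c b).
apply/ffunP => k; rewrite !ffunE ?E' ?E ?eqxx ?E.
case: (eqVneq k a) => [->|_]; first by rewrite ?E.
case: eqP => // _.
case: eqP => // _.
by apply: val_inj; rewrite /= -!conjgM; congr (_ ^ _)%g; rewrite conjgE !mulgA mulgV mul1g.
Qed.

Variables (kappa : fieldType) (zeta : kappa).

(* The [n]-th tensor power of the vector space with basis [R], as the vector
   space with basis the monomials of length [n]. *)
Definition tensor := {ffun monomial -> kappa^o}.

Definition basis_vec (t : monomial) : tensor := [ffun s => (s == t)%:R].

Definition linear_ext (f : monomial -> tensor) (v : tensor) : tensor :=
  \sum_(t : monomial) v t *: f t.

Definition lpos (i : 'I_n.-1) : 'I_n := widen_ord (leq_pred n) i.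
Definition rpos (i : 'I_n.-1) : 'I_n :=
  Ordinal (etrans (esym (ltn_predRL i n)) (ltn_ord i)).

Definition T_at (i : 'I_n.-1) : tensor -> tensor :=
  linear_ext (fun t => zeta *: basis_vec (braid_move (lpos i) (rpos i) t)).

Definition Tinv_at (i : 'I_n.-1) : tensor -> tensor :=
  linear_ext (fun t => zeta^-1 *: basis_vec (braid_moveV (lpos i) (rpos i) t)).

Definition letter_act (a : 'I_n.-1 * bool) : tensor -> tensor :=
  if a.2 then Tinv_at a.1 else T_at a.1.

Definition word_act (w : braid_word n) (v : tensor) : tensor :=
  foldr letter_act v w.

Definition braid_act (g : braid_group n) (v : tensor) : tensor :=
  word_act (generic_quotient.repr g) v.

Lemma lrpos_neq i : lpos i != rpos i.
Proof. by rewrite -val_eqE /= neq_ltn ltnSn. Qed.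

Lemma T_atE i v t :
  T_at i v t = zeta * v (braid_moveV (lpos i) (rpos i) t).
Proof.
rewrite /T_at /linear_ext sum_ffunE.
rewrite (bigD1 (braid_moveV (lpos i) (rpos i) t)) //= big1 => [|s].
  by rewrite !ffunE (braid_moveVK (lrpos_neq i)) eqxx addr0 [zeta *: _]mulr1 mulrC.
move=> /eqP st; rewrite !ffunE; case: eqP => [tE|_]; last by rewrite !scaler0.
by case: st; rewrite tE (braid_moveK (lrpos_neq i)).
Qed.

Lemma Tinv_atE i v t :
  Tinv_at i v t = zeta^-1 * v (braid_move (lpos i) (rpos i) t).
Proof.
rewrite /Tinv_at /linear_ext sum_ffunE.
rewrite (bigD1 (braid_move (lpos i) (rpos i) t)) //= big1 => [|s].
  by rewrite !ffunE (braid_moveK (lrpos_neq i)) eqxx addr0 [_ *: _%:R]mulr1 mulrC.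
move=> /eqP st; rewrite !ffunE; case: eqP => [tE|_]; last by rewrite !scaler0.
by case: st; rewrite tE (braid_moveVK (lrpos_neq i)).
Qed.

Lemma word_act_cat u w v : word_act (u ++ w) v = word_act u (word_act w v).
Proof. exact: foldr_cat. Qed.

Lemma word_act_eq u w v : zeta != 0 ->
  braid_eq u w -> word_act u v = word_act w v.
Proof.
move=> z0 uw; elim: uw v => {u w}
  [//|u w _ IH|u w x _ IH1 _ IH2|u u' w w' _ IH1 _ IH2|[i b]|i j ij|i j ij] v.
- by rewrite IH.
- by rewrite IH1.
- by rewrite !word_act_cat IH2 IH1.
- case: b; apply/ffunP => t; rewrite /= /letter_act /=.
    by rewrite Tinv_atE T_atE mulrA mulVf // mul1r (braid_moveK (lrpos_neq i)).
  by rewrite T_atE Tinv_atE mulrA mulfV // mul1r (braid_moveVK (lrpos_neq i)).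
- apply/ffunP => t; rewrite /= /letter_act /= !T_atE; congr (_ * (_ * v _)).
  have Ki := braid_moveVK (lrpos_neq i); have Kj := braid_moveVK (lrpos_neq j).
  have U : uniq [:: lpos i; rpos i; lpos j; rpos j].
    rewrite /= !inE -!val_eqE /= !eqSS; apply/and4P; split=> //; lia.
  apply: (can_inj (braid_moveK (lrpos_neq i))).
  apply: (can_inj (braid_moveK (lrpos_neq j))).
  by rewrite -(braid_move_far _ U) Kj Ki Ki Kj.
- apply/ffunP => t; rewrite /= /letter_act /= !T_atE; congr (_ * (_ * (_ * v _))).
  have Ki := braid_moveVK (lrpos_neq i); have Kj := braid_moveVK (lrpos_neq j).
  have jE : lpos j = rpos i by apply: val_inj.
  have U : uniq [:: lpos i; rpos i; rpos j].
    rewrite /= !inE -!val_eqE /= !eqSS; apply/and3P; split=> //; lia.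
  apply: (can_inj (braid_moveK (lrpos_neq i))).
  apply: (can_inj (braid_moveK (lrpos_neq j))).
  apply: (can_inj (braid_moveK (lrpos_neq i))).
  rewrite Ki Kj Ki; rewrite jE in Kj *.
  by rewrite (braid_move_artin _ U) Kj Ki Kj.
Qed.

Lemma braid_actE w v : zeta != 0 ->
  braid_act (braid_of_word w) v = word_act w v.
Proof. by move=> z0; apply: word_act_eq (repr_braid_of_word _). Qed.

Lemma braid_act_sigma i v : zeta != 0 -> braid_act (sigma i) v = T_at i v.
Proof. exact: braid_actE. Qed.

Lemma braid_act1 v : zeta != 0 -> braid_act 1%g v = v.
Proof. exact: braid_actE. Qed.

Lemma braid_actM g h v : zeta != 0 ->
  braid_act (g * h)%g v = braid_act g (braid_act h v).
Proof. by move=> z0; rewrite braid_actE // word_act_cat. Qed.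

End Tensors.

(* The [n]-th graded piece of C(kappa R_zeta). *)
Definition coinv_piece (kappa : fieldType) (zeta : kappa) (n : nat) : zmodType :=
  H0 (@braid_act n kappa zeta).

End RackAlgebra.

(* The degree of a graded object with pieces [A n]; it has none if infinitely
   many pieces are nonzero. *)
Definition has_degree (A : nat -> zmodType) (d : nat) : Prop :=
  (exists x : A d, x != 0) /\
  forall n, (exists x : A n, x != 0) -> (n <= d)%N.

Section Transpositions.
Variable N : nat.

Definition transposition_set : {set 'S_N} :=
  [set s | [exists i, exists j, (i != j) && (s == tperm i j)]].

Fact transposition_conj (s t : 'S_N) :
  s \in transposition_set -> (s ^ t)%g \in transposition_set.
Proof.
rewrite !inE => /existsP[i /existsP[j /andP[ij /eqP->]]].
apply/existsP; exists (t i); apply/existsP; exists (t j).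
by rewrite (inj_eq perm_inj) ij tpermJ eqxx.
Qed.

Definition transpositions : conj_set 'S_N := ConjSet transposition_conj.

End Transpositions.

(* Main.v *)
Require Import Defs.
From mathcomp Require Import all_boot all_order all_algebra.
From mathcomp Require Import all_fingroup all_solvable.
From mathcomp Require Import boolp.

Set Implicit Arguments.
Unset Strict Implicit.
Unset Printing Implicit Defensive.

Import GRing.Theory.
Local Open Scope ring_scope.

(** Each sigma_i sends a monomial to zeta times a monomial, so modulo the span
of the [g v - v] a monomial only changes by a power of zeta when it is moved
along its braid orbit. It is therefore killed as soon as [k] applications of
one generator bring it back to itself while [zeta ^+ k] differs from 1
([vanishes_fixed]), and being killed is inherited along orbits
([vanishes_move]).

For involutions the orbit of a pair (x, y) under one generator is read off
the dihedral group that they generate: with c = xy the successive pairs are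
(x c^k, x c^(k+1)), so the pair returns after any [k] with c^k = 1
([iter_move_invol], [vanishes_invol]).

(a) If x and y lie outside the index 2 subgroup H, then xy lies in H, and the
pair returns after exponent H steps. Hence every monomial of length at least 2
dies. In degree 1 the braid group is trivial and nothing dies.

(b) Two transpositions with overlapping supports satisfy (xy)^3 = 1
([transpositions_expg3]), and zeta^3 is not 1, so the adjacent entries of a
surviving monomial have disjoint supports. Since a generator brings an entry
one step to the left, unchanged, this extends to all pairs of entries
([surviving_disjoint]). Thus a surviving monomial consists of transpositions
with pairwise disjoint supports of size 2, which leaves room for at most N / 2
of them. Degree 0 is nonzero, so the degree exists. *)

(** * Coinvariants *)

Section Coinvariants.
Variables (kappa : fieldType) (B : groupType) (M : lmodType kappa).
Variable act : B -> M -> M.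

Lemma H0_nonzeroP :
  (exists x : H0 act, x != 0) <-> exists v, v \notin coinv_sub act.
Proof.
have pi0 v : ((\pi_(H0 act) v)%qT == 0 :> H0 act) = (v \in coinv_sub act).
  rewrite -[in RHS](subr0 v) Quotient.idealrBE; congr (_ == _).
  by rewrite [in RHS]raddf0.
split=> [[x x0]|[v v0]]; last by exists (\pi_(H0 act) v)%qT; rewrite pi0.
by exists (generic_quotient.repr x); rewrite -pi0 reprK.
Qed.

Lemma coinv_sub_act g v : act g v - v \in coinv_sub act.
Proof. by apply/asboolP; exists [:: (1, (g, v))]; rewrite big_seq1 scale1r. Qed.

Lemma coinv_subZ c v : v \in coinv_sub act -> c *: v \in coinv_sub act.
Proof.
move=> /asboolP[s ->]; apply/asboolP; exists [seq (c * p.1, p.2) | p <- s].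
by rewrite big_map scaler_sumr; apply: eq_bigr => p _; rewrite scalerA.
Qed.

(** This is applied to braid groups on at most one strand, which have no
generators. *)
Lemma coinv_sub_trivial v :
  (forall g w, act g w = w) -> v \in coinv_sub act -> v = 0.
Proof.
move=> act1 /asboolP[s ->]; apply: big1 => p _.
by rewrite act1 subrr scaler0.
Qed.

End Coinvariants.

(** * Monomials modulo the braid action *)

Section Monomials.
Variables (G : finGroupType) (R : conj_set G).
Variables (kappa : fieldType) (zeta : kappa) (n : nat).
Hypothesis zeta_neq0 : zeta != 0.
Implicit Types (t : monomial R n) (v : tensor R n kappa) (i : 'I_n.-1).

Local Notation boundary := (coinv_sub (@braid_act _ R n _ zeta)).
Local Notation bvec := (basis_vec kappa).

Definition vanishes t := bvec t \in boundary.

Lemma tensorE v : v = \sum_t v t *: bvec t.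
Proof.
apply/ffunP => t; rewrite sum_ffunE (bigD1 t) //= big1 => [|s st].
  by rewrite !ffunE eqxx addr0 [_ *: _]mulr1.
by rewrite !ffunE eq_sym (negPf st) scaler0.
Qed.

(** The monomials span, so a graded piece can only be nonzero if one of them
survives. *)
Lemma surviving_monomial :
  (exists x : coinv_piece R zeta n, x != 0) -> exists t, ~~ vanishes t.
Proof.
move=> /H0_nonzeroP[v vN]; apply/existsP; apply: contraNT vN => /existsPn van.
rewrite [v]tensorE rpred_sum // => t _; apply: coinv_subZ.
by have /negPn := van t.
Qed.

Definition move_at i := @braid_move _ R n (lpos i) (rpos i).

Lemma T_at_bvec i t : T_at zeta i (bvec t) = zeta *: bvec (move_at i t).
Proof.
apply/ffunP => s; rewrite T_atE !ffunE; congr (_ * (_ : bool)%:R).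
apply/eqP/eqP => [<-|->]; first by rewrite /move_at braid_moveVK ?lrpos_neq.
by rewrite braid_moveK ?lrpos_neq.
Qed.

(** Telescoping sum of the relations [T_at i w - w], with
[w = zeta ^+ k *: bvec (iter k (move_at i) t)]. *)
Lemma bvec_iter_move i k t :
  zeta ^+ k *: bvec (iter k (move_at i) t) - bvec t \in boundary.
Proof.
elim: k => [|k IH] /=; first by rewrite expr0 scale1r subrr rpred0.
rewrite -(subrKA (zeta ^+ k *: bvec (iter k (move_at i) t))) rpredD //.
rewrite exprSr -scalerA -scalerBr -T_at_bvec coinv_subZ //.
rewrite -braid_act_sigma //; exact: coinv_sub_act.
Qed.

(** Modulo [boundary], [bvec t] is a multiple of [bvec (move_at i t)]. *)
Lemma vanishes_move i t : vanishes (move_at i t) -> vanishes t.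
Proof.
move=> van; rewrite /vanishes -[bvec t]opprK rpredN.
have := bvec_iter_move i 1 t; rewrite expr1 /= => H.
rewrite -(rpredDl (x := zeta *: bvec (move_at i t))) //.
exact: coinv_subZ.
Qed.

(** Here [(zeta ^+ k - 1) *: bvec t] is a boundary with an invertible
coefficient. *)
Lemma vanishes_fixed i k t :
  iter k (move_at i) t = t -> zeta ^+ k != 1 -> vanishes t.
Proof.
move=> fixt zk; have := bvec_iter_move i k t.
rewrite fixt -[X in _ - X]scale1r -scalerBl => /(coinv_subZ (zeta ^+ k - 1)^-1).
by rewrite scalerA mulVf ?scale1r // subr_eq0.
Qed.

Hypothesis invol : forall x : G, x \in (R : {set G}) -> (x * x = 1)%g.

(** Write x, y for the entries of the pair and c = xy, so that y = xc as
x^2 = 1. One step takes (x, y) to (y, y^-1 x y), and y^-1 x y = y (x y) = y c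
as y^2 = 1: both entries are multiplied by c on the right, and their product
stays equal to c. *)
Lemma iter_move_invol i k t (x := val (t (lpos i))) (c := (x * val (t (rpos i)))%g) :
  [/\ val (iter k (move_at i) t (lpos i)) = (x * c ^+ k)%g,
      val (iter k (move_at i) t (rpos i)) = (x * c ^+ k.+1)%g &
      forall j, j != lpos i -> j != rpos i -> iter k (move_at i) t j = t j].
Proof.
have xx : (x * x = 1)%g by apply: invol; apply: valP.
elim: k => [|k [IHl IHr IHo]] /=.
  by rewrite expg0 expg1 mulg1 /c mulgA xx mul1g.
rewrite /move_at /braid_move !ffunE eqxx; split=> // [|j jl jr].
  rewrite eq_sym (negPf (lrpos_neq i)) eqxx /= -/(move_at i).
  set s := iter k _ t in IHl IHr IHo *.
  have ss : (val (s (lpos i)) * val (s (lpos i)) = 1)%g by apply/invol/valP.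
  have rr : (val (s (rpos i)) * val (s (rpos i)) = 1)%g by apply/invol/valP.
  have rlc : val (s (rpos i)) = (val (s (lpos i)) * c)%g.
    by rewrite IHl IHr expgSr mulgA.
  rewrite conjgE; have -> : ((val (s (rpos i)))^-1 = val (s (rpos i)))%g.
    by apply/eqP; rewrite eq_invg_mul rr.
  have -> : (val (s (lpos i)) * val (s (rpos i)) = c)%g.
    by rewrite rlc mulgA ss mul1g.
  by rewrite IHr -mulgA -expgSr.
by rewrite ffunE (negPf jl) (negPf jr) IHo.
Qed.

Lemma vanishes_invol i k t :
  ((val (t (lpos i)) * val (t (rpos i))) ^+ k = 1)%g ->
  zeta ^+ k != 1 -> vanishes t.
Proof.
move=> ck; apply: (vanishes_fixed (i := i)).
have [El Er Eo] := iter_move_invol i k t.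
apply/ffunP => j; case: (eqVneq j (lpos i)) => [->|jl].
  by apply: val_inj; rewrite El ck mulg1.
case: (eqVneq j (rpos i)) => [->|jr]; last exact: Eo.
apply: val_inj; rewrite Er expgS ck mulg1 mulgA invol ?mul1g //.
exact: valP.
Qed.

End Monomials.

(** * Involutions outside a subgroup of index 2 *)

Lemma coinv_piece_le1_nonzero (G : finGroupType) (R : conj_set G) (kappa : fieldType)
    (zeta : kappa) n (t : monomial R n) :
  (n <= 1)%N -> exists x : coinv_piece R zeta n, x != 0.
Proof.
move=> n1; apply/H0_nonzeroP; exists (basis_vec kappa t).
apply/negP => /coinv_sub_trivial bt.
suff /bt/ffunP/(_ t)/eqP : forall g w, @braid_act _ R n _ zeta g w = w.
  by rewrite !ffunE eqxx oner_eq0.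
move=> g w; rewrite /braid_act.
case: (generic_quotient.repr g) => // -[[i i0] b] u; exfalso.
by move: n1 i0; clear; case: n => [|[]].
Qed.

Lemma prim_root_neq0 (kappa : fieldType) (zeta : kappa) m :
  m.-primitive_root zeta -> zeta != 0.
Proof.
move=> prim; apply: contra_eq_neq (prim_expr_order prim) => ->.
by rewrite expr0n eqn0Ngt (prim_order_gt0 prim) eq_sym oner_neq0.
Qed.

(** The coset [x^-1 *: H] avoids H, hence is its complement, which contains
y. *)
Lemma index2_mulg (G : finGroupType) (H : {group G}) x y :
  #|[set: G] : H|%g = 2%N -> x \notin H -> y \notin H -> (x * y)%g \in H.
Proof.
move=> iH xH yH; have cardH : #|~: H| = #|H|.
  have := Lagrange (subsetT H); rewrite iH muln2 -addnn cardsT -(cardsC H).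
  by move=> /addnI->.
have : (x^-1 *: H)%g == ~: H.
  rewrite eqEcard card_lcoset cardH leqnn andbT.
  apply/subsetP=> z; rewrite mem_lcoset invgK inE.
  by apply: contraL => zH; rewrite groupMr.
by move=> /eqP/setP/(_ y); rewrite mem_lcoset invgK inE yH.
Qed.

(** In length at least 2 the first two entries already kill any monomial. *)
Lemma coinv_deg_index2 (kappa : fieldType) (G : finGroupType) (H : {group G})
    (R : conj_set G) (zeta : kappa) m :
  #|[set: G] : H|%g = 2%N -> (R : {set G}) != set0 ->
  (R : {set G}) \subset [set: G] :\: H ->
  (forall x : G, x \in (R : {set G}) -> #[x]%g = 2%N) ->
  m.-primitive_root zeta -> ~~ (m %| exponent H)%N ->
  has_degree (coinv_piece R zeta) 1.
Proof.
move=> iH /set0Pn[x Rx] RH ordR prim mH; have z0 := prim_root_neq0 prim.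
have invol y : y \in (R : {set G}) -> (y * y = 1)%g.
  by move=> /ordR oy; rewrite -[(y * y)%g]/(y ^+ 2)%g -oy expg_order.
split; first exact: (coinv_piece_le1_nonzero zeta [ffun=> exist _ x Rx : elt R]).
case=> [|[|n]] // /surviving_monomial[t /negP[]].
pose i : 'I_n.+2.-1 := ord0.
apply: (vanishes_invol z0 invol (i := i) (k := exponent H)); last first.
  by rewrite -(prim_order_dvd prim).
apply: (expg_exponent (A := H)); apply: index2_mulg => //.
  by have := subsetP RH _ (valP (t (lpos i))); rewrite inE => /andP[].
by have := subsetP RH _ (valP (t (rpos i))); rewrite inE => /andP[].
Qed.

(** * Transpositions *)

Section Transpositions.
Variable N : nat.
Implicit Types s t : 'S_N.

Definition moved s := [set z | s z != z].

Lemma moved_tperm (i j : 'I_N) : i != j -> moved (tperm i j) = [set i; j].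
Proof.
move=> ij; apply/setP => z; rewrite !inE.
by case: tpermP => [->|->|/eqP/negPf-> /eqP/negPf->]; rewrite ?eqxx ?orbT // eq_sym.
Qed.

Lemma transpositionP s :
  reflect (exists i j, i != j /\ s = tperm i j) (s \in transposition_set N).
Proof.
rewrite inE; apply: (iffP existsP) => [[i /existsP[j /andP[ij /eqP->]]]|].
  by exists i, j.
by move=> [i [j [ij ->]]]; exists i; apply/existsP; exists j; rewrite ij eqxx.
Qed.

Lemma transposition_invol s : s \in transposition_set N -> (s * s = 1)%g.
Proof. by move=> /transpositionP[i [j [_ ->]]]; rewrite tperm2. Qed.

Lemma card_moved s : s \in transposition_set N -> #|moved s| = 2%N.
Proof.
by move=> /transpositionP[i [j [ij ->]]]; rewrite moved_tperm // cards2 ij.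
Qed.

Lemma moved_tpermP s a : s \in transposition_set N -> a \in moved s ->
  exists2 b, a != b & s = tperm a b.
Proof.
move=> /transpositionP[i [j [ij ->]]]; rewrite moved_tperm // !inE.
case/orP=> /eqP->; first by exists j.
by exists i; [rewrite eq_sym | rewrite tpermC].
Qed.

(** If the supports meet in [a], then s = (a b) and t = (a c). Either b = c and
s = t, so that st = 1, or (st)^3 = (sts)(tst) = (t ^ s)(s ^ t), where both
conjugates are the transposition (b c). *)
Lemma transpositions_expg3 s t :
  s \in transposition_set N -> t \in transposition_set N ->
  ~~ [disjoint moved s & moved t] -> ((s * t) ^+ 3 = 1)%g.
Proof.
move=> Rs Rt; rewrite -setI_eq0 => /set0Pn[a]; rewrite inE => /andP[sa ta].
have [b ab {sa}Es] := moved_tpermP Rs sa; have [c ac {ta}Et] := moved_tpermP Rt ta.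
case: (eqVneq b c) => [bc|bc].
  by rewrite Es Et -bc tperm2 expg1n.
have -> : ((s * t) ^+ 3 = t ^ s * s ^ t)%g.
  have sV : (s^-1 = s)%g by rewrite Es tpermV.
  have tV : (t^-1 = t)%g by rewrite Et tpermV.
  by rewrite !conjgE sV tV !expgS expg0 mulg1 !mulgA.
rewrite [X in (X ^ s * _)%g]Et [X in (_ * X ^ t)%g]Es !tpermJ Es Et !tpermL.
by rewrite !tpermD ?tperm2 // 1?eq_sym // tpermC tperm2.
Qed.

Lemma disjoint_moved_bound n (t : 'I_n -> 'S_N) :
  (forall i, t i \in transposition_set N) ->
  (forall i j : 'I_n, (i < j)%N -> [disjoint moved (t i) & moved (t j)]) ->
  (n <= N %/ 2)%N.
Proof.
move=> Rt dis; rewrite leq_divRL // -[X in (_ <= X)%N]card_ord.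
have disN i j : i != j -> [disjoint moved (t i) & moved (t j)].
  by rewrite neq_ltn => /orP[/dis//|/dis]; rewrite disjoint_sym.
apply: leq_trans (max_card (\bigcup_i moved (t i))).
rewrite -sum1_card partition_disjoint_bigcup //=.
under eq_bigr => i _ do rewrite sum1_card card_moved //.
by rewrite sum_nat_const card_ord.
Qed.

Section Surviving.
Variables (kappa : fieldType) (zeta : kappa) (n : nat).
Hypothesis zeta3 : zeta ^+ 3 != 1.
Hypothesis zeta_neq0 : zeta != 0.

(** Induction on the distance from [i] to [j]. At distance 1, an overlap would
give (xy)^3 = 1 and kill [t]. Otherwise moving the entry at [j] one step to the
left gives another surviving monomial, with the same entry at [i]. *)
Lemma surviving_disjoint (t : monomial (transpositions N) n) (i j : 'I_n) :
  ~~ vanishes zeta t -> (i < j)%N ->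
  [disjoint moved (val (t i)) & moved (val (t j))].
Proof.
move=> + ij; have [d jE] : exists d, j = (i + d).+1 :> nat.
  by exists (j - i).-1; rewrite -addnS prednK ?subn_gt0 // subnKC // ltnW.
(* Both cases apply the generator acting on positions j - 1 and j. *)
elim: d t j jE {ij} => [|d IH] t j jE surv.
all: have kP : (j.-1 < n.-1)%N by rewrite jE /= ltn_predRL -jE.
all: have jr : rpos (Ordinal kP) = j by apply: val_inj; rewrite /= jE.
  have il : lpos (Ordinal kP) = i by apply: val_inj; rewrite /= jE addn0.
  apply: contraNT surv => /transpositions_expg3 c3.
  have invol : forall s, s \in (transpositions N : {set 'S_N}) -> (s * s = 1)%g.
    exact: transposition_invol.
  apply: (vanishes_invol zeta_neq0 invol (i := Ordinal kP) _ zeta3).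
  by rewrite jr il; apply: c3; apply: valP.
have lE : lpos (Ordinal kP) = (i + d).+1 :> nat by rewrite /= jE addnS.
have il : (i == lpos (Ordinal kP)) = false.
  by apply/eqP=> E; have := leq_addr d i; rewrite -ltnS -lE -E ltnn.
have ij : (i == j) = false.
  by apply/eqP=> E; have := leq_addr d.+1 i; rewrite -ltnS -jE -E ltnn.
have /(IH _ _ lE) := contra (@vanishes_move _ _ _ _ _ zeta_neq0 (Ordinal kP) t) surv.
by rewrite !ffunE eqxx jr il ij.
Qed.

Lemma coinv_transpositions_bound :
  (exists x : coinv_piece (transpositions N) zeta n, x != 0) -> (n <= N %/ 2)%N.
Proof.
move=> /surviving_monomial[t surv].
apply: (disjoint_moved_bound (t := fun i => val (t i))) => [i|i j].
  exact: valP.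
exact: surviving_disjoint.
Qed.

End Surviving.
End Transpositions.

(** * The degree *)

Lemma has_degree_bounded (A : nat -> zmodType) b :
  (exists x : A 0%N, x != 0) ->
  (forall n, (exists x : A n, x != 0) -> (n <= b)%N) ->
  exists2 d, has_degree A d & (d <= b)%N.
Proof.
move=> A0 Ab; pose P n := `[< exists x : A n, x != 0 >].
have exP : exists n, P n by exists 0%N; apply/asboolP.
have [|d /asboolP Ad dmax] := ex_maxnP exP (m := b).
  by move=> n /asboolP; apply: Ab.
by exists d; [split=> // n An; apply: dmax; apply/asboolP | apply: Ab].
Qed.

Theorem proposition5p5p13 (kappa : fieldType) :
  (forall (G : finGroupType) (H : {group G}) (R : conj_set G)
          (zeta : kappa) (m : nat),
     #|[set: G] : H|%g = 2%N ->
     (R : {set G}) != set0 ->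
     (R : {set G}) \subset [set: G] :\: H ->
     (forall x : G, x \in (R : {set G}) -> #[x]%g = 2%N) ->
     (m.-primitive_root zeta)%R ->
     ~~ (m %| exponent H)%N ->
     has_degree (coinv_piece R zeta) 1)
  /\
  (forall (N : nat) (zeta : kappa) (m : nat),
     (m.-primitive_root zeta)%R ->
     ~~ (m %| 3)%N ->
     exists2 d : nat,
       has_degree (coinv_piece (transpositions N) zeta) d & (d <= N %/ 2)%N).
Proof.
split=> [G H R zeta m|N zeta m prim m3]; first exact: coinv_deg_index2.
apply: has_degree_bounded => [|n].
  (* The empty monomial: its entries are indexed by the empty type ['I_0]. *)
  by apply: coinv_piece_le1_nonzero => //; apply: (@finfun _ (fun=> _)) => -[].
apply: coinv_transpositions_bound (prim_root_neq0 prim).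
by rewrite -(prim_order_dvd prim).
Qed.
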